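(* Let $A\in\mathbb{C}^{n\times n}$ be normal, let $\theta\in\mathbb{C}$ with $|\theta|=1$, let $1\le k\le n$, and let $E\in\mathbb{C}^{n\times n}$ be a $\theta$-Hermitian matrix of rank $k$. Then $A+E$ is normal if and only if there exist $m\ge1$, positive integers $s_1,\dots,s_m$, non-negative integers $k_1,\dots,k_m$ with $k_1+\dots+k_m=k$, numbers $y_1,\dots,y_m\in\mathbb{C}$ such that the parallel lines $$\ell_j=\{y_j+\theta\rho:\rho\in\mathbb{R}\},\qquad j=1,\dots,m,$$ are distinct, and a unitary $U\in\mathbb{C}^{n\times n}$ whose columns are eigenvectors of $A$, such that $$U^*AU=\mathrm{diag}(\Lambda_1,\dots,\Lambda_m,B),\qquad U^*EU=\mathrm{diag}(\theta H_1,\dots,\theta H_m,0),$$ where, for each $j$, $\Lambda_j=y_jI_{s_j}+\theta R_j$ with $R_j\in\mathbb{R}^{s_j\times s_j}$ diagonal, $H_j\in\mathbb{C}^{s_j\times s_j}$ is Hermitian of rank $k_j$, and $B$ is diagonal. In that case, as a result of the perturbation at most $s_1+\dots+s_m$ eigenvalues of $A$ are perturbed (the eigenvalues of $B$ remain eigenvalues of $A+E$), and these perturbed eigenvalues are located on the at most $m$ distinct parallel lines $\ell_1,\dots,\ell_m$. Moreover, the eigenvalues of $A+tE$, $t\in[0,1]$, connect the perturbed eigenvalues (those of $A+E$) with those of $A$ by line segments that lie on $\ell_1,\dots,\ell_m$.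
   Context: For unimodular $\theta$, a square complex matrix $M$ is called $\theta$-Hermitian if $\overline{\theta}M$ is Hermitian. Eigenvalues are counted with multiplicity; $\mathrm{diag}(\cdot)$ of matrices denotes a block diagonal matrix. The trailing blocks $B$ and $0$ may have size $0$. *)

(* Defs.v *)
From HB Require Import structures.
From mathcomp Require Import all_boot all_order all_algebra.
From mathcomp Require Import sesquilinear spectral.
From mathcomp Require Import complex.
From mathcomp Require Import boolp classical_sets set_interval reals.
From mathcomp Require Import topology normedtype.

Set Implicit Arguments.
Unset Strict Implicit.
Unset Printing Implicit Defensive.

Import Order.TTheory GRing.Theory Num.Theory.
Import numFieldNormedType.Exports.

Local Open Scope ring_scope.
Local Open Scope sesquilinear_scope.
Local Open Scope classical_set_scope.

Definition theta_hermitian (C : numClosedFieldType) (n : nat) (theta : C)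
    (M : 'M[C]_n) : Prop :=
  theta^* *: M \is hermsymmx.

(* [z] lists the eigenvalues of [M], each repeated according to its (algebraic)
   multiplicity, in some order; in particular [size z = n]. *)
Definition spectrum_is (C : numClosedFieldType) (n : nat) (M : 'M[C]_n)
    (z : seq C) : Prop :=
  char_poly M = \prod_(x <- z) ('X - x%:P).

Definition is_eigenvector (C : numClosedFieldType) (n : nat) (M : 'M[C]_n)
    (v : 'cV[C]_n) : Prop :=
  v != 0 /\ exists a : C, M *m v = a *: v.

(* diag(D_0, ..., D_(m-1), B); the cast only transports along the equation
   between the total block size and n. *)
Definition bdiag (C : numClosedFieldType) (n m q : nat) (s : 'I_m -> nat)
    (e : (\sum_(j < m) s j + q)%N = n)
    (D : forall j : 'I_m, 'M[C]_(s j)) (B : 'M[C]_q) : 'M[C]_n :=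
  castmx (e, e) (block_mx (\mxdiag_(j < m) D j) 0 0 B).

Section Complex.
Variable R : realType.
Notation C := (R[i]).

Definition line (theta y : C) : set C :=
  [set y + theta * real_complex R rho | rho in [set: R]].

Definition is_segment (X : set C) : Prop :=
  exists p q : C,
    X = [set p + real_complex R t * (q - p) | t in `[0 : R, 1 : R]].

(* [n] is the common order of [A] and [E]; [q] is the order of the trailing
   blocks [B] and [0]. *)
Definition block_form (n k : nat) (theta : C) (A E : 'M[C]_n)
    (m : nat) (s : 'I_m -> nat) (y : 'I_m -> C) (q : nat) (B : 'M[C]_q) : Prop :=
  [/\ (0 < m)%N,
      (forall j, 0 < s j)%N,
      injective (fun j => line theta (y j)),
      is_diag_mx B
    & exists (e : (\sum_(j < m) s j + q)%N = n)
             (ks : 'I_m -> nat)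
             (U : 'M[C]_n)
             (D : forall j : 'I_m, 'M[R]_(s j))
             (H : forall j : 'I_m, 'M[C]_(s j)),
        [/\ (\sum_(j < m) ks j)%N = k,
            U \is unitarymx /\ (forall i, is_eigenvector A (col i U)),
            (forall j, is_diag_mx (D j)),
            (forall j, H j \is hermsymmx /\ \rank (H j) = ks j)
          & U ^t* *m A *m U =
              bdiag e (fun j => (y j)%:M +
                                theta *: map_mx (real_complex R) (D j)) B
            /\ U ^t* *m E *m U =
              bdiag e (fun j => theta *: H j) 0]].

(* With S = s_1 + ... + s_m: the eigenvalues of B (the list [b]) are kept, and
   the other S eigenvalues of A + tE are the values at t of S continuous curves
   on [0, 1]; each curve runs along a line segment contained in one of the
   lines, from an eigenvalue of A (t = 0) to one of A + E (t = 1).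
   Continuity is for the usual topology of the complex numbers, which the
   cast to [numFieldType] makes available. *)
Definition eigenvalue_motion (n : nat) (theta : C) (A E : 'M[C]_n)
    (m : nat) (s : 'I_m -> nat) (y : 'I_m -> C) (q : nat) (B : 'M[C]_q) : Prop :=
  let S := (\sum_(j < m) s j)%N in
  exists (b : seq C) (a a' : 'I_S -> C) (gamma : 'I_S -> R -> C),
    [/\ spectrum_is B b,
        spectrum_is A (codom a ++ b),
        spectrum_is (A + E) (codom a' ++ b),
        (forall i, exists j, line theta (y j) (a' i))
      & (forall i,
          [/\ {within `[0 : R, 1 : R],
                 continuous (gamma i : R -> (C : numFieldType))},
              gamma i 0 = a i, gamma i 1 = a' i
            & exists j, is_segment [set gamma i t | t in `[0 : R, 1 : R]] /\
                [set gamma i t | t in `[0 : R, 1 : R]] `<=` line theta (y j)])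
        /\ (forall t : R, t \in `[0 : R, 1 : R] ->
             spectrum_is (A + real_complex R t *: E)
               ([seq gamma i t | i : 'I_S] ++ b))].

End Complex.

(* Main.v *)
(* After dividing by theta, E becomes a Hermitian matrix h, and for a normal a the
   matrix a + h is normal iff h commutes with a - a^*.  In an orthonormal
   eigenbasis of a this says that h only couples eigenvalues of a with equal
   imaginary part; grouping the basis by imaginary part yields the blocks, one
   per line, with an empty trailing block B.  For the motion of the eigenvalues,
   each block of A + tE is y + theta (R + tH) with R + tH Hermitian, whose
   increasingly ordered real eigenvalues are Lipschitz in t by Weyl's inequality;
   the image of [0, 1] under such a function is a compact interval. *)
Require Import Defs.
From mathcomp Require Import all_boot all_order all_fingroup all_algebra.
From mathcomp Require Import sesquilinear spectral.
From mathcomp Require Import complex.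
From mathcomp Require Import reals.
From mathcomp Require Import boolp classical_sets topology normedtype derive.
From mathcomp Require Import ring.

Import Order.TTheory GRing.Theory Num.Theory.
Import numFieldNormedType.Exports.
Local Open Scope ring_scope.
Local Open Scope sesquilinear_scope.
Set Implicit Arguments.
Unset Strict Implicit.
Unset Printing Implicit Defensive.

(** * Conjugate transposes, unitary conjugation and spectral decompositions *)

Section ConjugateTranspose.
Variable C : numClosedFieldType.

Lemma hermsymmxE n (M : 'M[C]_n) : (M \is hermsymmx) = (M == M ^t*).
Proof. by rewrite is_hermitianmxE expr0 scale1r. Qed.

Lemma hermsymmxP n {M : 'M[C]_n} : reflect (M ^t* = M) (M \is hermsymmx).
Proof. by rewrite hermsymmxE eq_sym; apply: eqP. Qed.

Lemma trmxC_mul m n p (A : 'M[C]_(m, n)) (B : 'M[C]_(n, p)) :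
  (A *m B) ^t* = B ^t* *m A ^t*.
Proof. by rewrite trmx_mul map_mxM. Qed.

Lemma trmxCD m n (A B : 'M[C]_(m, n)) : (A + B) ^t* = A ^t* + B ^t*.
Proof. by rewrite linearD map_mxD. Qed.

Lemma trmxCZ m n a (A : 'M[C]_(m, n)) : (a *: A) ^t* = a^* *: A ^t*.
Proof. by rewrite linearZ map_mxZ. Qed.

Lemma trmxC_scalar n (a : C) : (a%:M : 'M_n) ^t* = (a^*)%:M.
Proof. by rewrite tr_scalar_mx map_scalar_mx. Qed.

Lemma trmxC_diag n (d : 'rV[C]_n) : (diag_mx d) ^t* = diag_mx (map_mx Num.conj d).
Proof. by rewrite tr_diag_mx map_diag_mx. Qed.

Lemma unitarymxK n {P : 'M[C]_n} : P \is unitarymx -> P ^t* *m P = 1%:M.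
Proof. by move=> /unitarymxP/mulmx1C. Qed.

Lemma hermsymmx_conj n (P M : 'M[C]_n) :
  M \is hermsymmx -> P *m M *m P ^t* \is hermsymmx.
Proof.
by move=> /hermsymmxP hM; apply/hermsymmxP; rewrite !trmxC_mul trmxCK hM mulmxA.
Qed.

Lemma hermsymmx_mxsub m n (f : 'I_m -> 'I_n) (M : 'M[C]_n) :
  M \is hermsymmx -> mxsub f f M \is hermsymmx.
Proof.
move=> /hermsymmxP hM; apply/hermsymmxP/matrixP => a b.
by rewrite -[in RHS]hM !mxE.
Qed.

Lemma normalmx_conj n (P M : 'M[C]_n) :
  P \is unitarymx -> (P ^t* *m M *m P \is normalmx) = (M \is normalmx).
Proof.
move=> hP; have conj (X Y : 'M[C]_n) :
    P ^t* *m X *m P *m (P ^t* *m Y *m P) = P ^t* *m (X *m Y) *m P.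
  by rewrite !mulmxA mulmxtVK.
have inj (X Y : 'M[C]_n) : P ^t* *m X *m P = P ^t* *m Y *m P -> X = Y.
  move=> /(congr1 (fun Z => P *m Z *m P ^t*)).
  by rewrite !mulmxA (unitarymxP hP) !mul1mx !mulmxtVK.
have tr : (P ^t* *m M *m P) ^t* = P ^t* *m M ^t* *m P.
  by rewrite !trmxC_mul trmxCK mulmxA.
apply/normalmxP/normalmxP; rewrite tr !conj.
  exact: inj.
by move=> ->.
Qed.

Lemma normalmx_affine n (y a : C) (M : 'M[C]_n) :
  M \is normalmx -> y%:M + a *: M \is normalmx.
Proof.
move=> /normalmxP hM; apply/normalmxP.
rewrite trmxCD trmxCZ trmxC_scalar !mulmxDl !mulmxDr.
rewrite !mul_scalar_mx !mul_mx_scalar -!scalemxAl -!scalemxAr hM.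
rewrite !scalerA [a * _]mulrC scale_scalar_mx [y * _]mulrC !addrA; congr (_ + _).
by rewrite scale_scalar_mx addrAC ![_ * y]mulrC [_ * a]mulrC.
Qed.

Lemma normalmx_diagP n (M : 'M[C]_n) : M \is normalmx ->
  exists2 P : 'M[C]_n, P \is unitarymx &
  exists d : 'rV[C]_n, M = P ^t* *m diag_mx d *m P.
Proof.
move=> /orthomx_spectralP eM; have hP := spectral_unitarymx M.
exists (spectralmx M) => //; exists (spectral_diag M).
by rewrite -(invmx_unitary hP).
Qed.

Lemma hermsymmx_diagP n (M : 'M[C]_n) : M \is hermsymmx ->
  exists2 P : 'M[C]_n, P \is unitarymx &
  exists2 d : 'rV[C]_n, d \is a realmx & M = P ^t* *m diag_mx d *m P.
Proof.
move=> hM; have hP := spectral_unitarymx M.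
exists (spectralmx M) => //; exists (spectral_diag M).
  exact: hermitian_spectral_diag_real.
have /orthomx_spectralP := hermitian_normalmx hM.
by rewrite (invmx_unitary hP).
Qed.

(** * Characteristic polynomials of conjugate, block diagonal and diagonal matrices *)

Lemma char_poly_conj n (P M : 'M[C]_n) : P \is unitarymx ->
  char_poly (P ^t* *m M *m P) = char_poly M.
Proof.
move=> hP; rewrite /char_poly /char_poly_mx.
set Q := map_mx polyC (P ^t*); set Q' := map_mx polyC P.
have QQ' : Q *m Q' = 1%:M by rewrite -map_mxM unitarymxK // map_mx1.
have -> : 'X%:M - map_mx polyC (P ^t* *m M *m P) =
          Q *m ('X%:M - map_mx polyC M) *m Q'.
  rewrite !map_mxM mulmxBr mulmxBl; congr (_ - _).
  by rewrite mul_mx_scalar -scalemxAl QQ' scalemx1.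
by rewrite !det_mulmx mulrAC -det_mulmx QQ' det1 mul1r.
Qed.

Lemma char_poly_block_diag m n (A : 'M[C]_m) (B : 'M[C]_n) :
  char_poly (block_mx A 0 0 B) = char_poly A * char_poly B.
Proof. by rewrite /char_poly char_block_diag_mx det_ublock. Qed.

Lemma char_poly_mxdiag m (s : 'I_m -> nat) (D : forall j, 'M[C]_(s j)) :
  char_poly (\mxdiag_j D j) = \prod_j char_poly (D j).
Proof.
elim: m => [|m IHm] in s D *.
  (* Generalising the matrix first lets its dimension, an empty sum, be rewritten to 0. *)
  move: (\mxdiag__ _); rewrite !big_ord0 => M.
  by rewrite /char_poly det_mx00.
rewrite mxdiag_recl [RHS]big_ord_recl /= -IHm.
by case: _ / mxsize_recl; rewrite castmx_id char_poly_block_diag.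
Qed.

Lemma char_poly_diag n (d : 'rV[C]_n) :
  char_poly (diag_mx d) = \prod_i ('X - (d 0 i)%:P).
Proof.
rewrite char_poly_trig ?diag_mx_is_trig //.
by apply: eq_bigr => i _; rewrite mxE eqxx.
Qed.

(** * Algebra and normality of block diagonal matrices *)

Lemma mul_mxdiag m (s : 'I_m -> nat) (D D' : forall j, 'M[C]_(s j)) :
  (\mxdiag_j D j) *m (\mxdiag_j D' j) = \mxdiag_j (D j *m D' j).
Proof.
rewrite [X in _ *m X]/mxdiag mul_mxdiag_mxblock; apply: eq_mxblock => i j.
by case: eqVneq => [->|_]; rewrite ?mulmx0 // !conform_mx_id.
Qed.

Lemma trmxC_mxdiag m (s : 'I_m -> nat) (D : forall j, 'M[C]_(s j)) :
  (\mxdiag_j D j) ^t* = \mxdiag_j (D j ^t*).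
Proof.
rewrite tr_mxdiag; apply/matrixP => k l; rewrite !mxE /tagnat.sig1 /tagnat.sig2.
case: (tagnat.sig k) (tagnat.sig l) => [i a] [j b] /=.
case: (i =P j) => [eij|_]; last by rewrite !mxE rmorph0.
by case: _ / eij in b *; rewrite !conform_mx_id !mxE.
Qed.

Lemma normalmx_mxdiag m (s : 'I_m -> nat) (D : forall j, 'M[C]_(s j)) :
  (forall j, D j \is normalmx) -> \mxdiag_j D j \is normalmx.
Proof.
move=> hD; apply/normalmxP; rewrite trmxC_mxdiag !mul_mxdiag.
by apply: eq_mxdiag => j; apply/normalmxP.
Qed.

Lemma normalmx_block_diag m n (A : 'M[C]_m) (B : 'M[C]_n) :
  A \is normalmx -> B \is normalmx -> block_mx A 0 0 B \is normalmx.
Proof.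
move=> /normalmxP hA /normalmxP hB; apply/normalmxP.
rewrite tr_block_mx map_block_mx !trmx0 !map_mx0 !mulmx_block.
by rewrite !mulmx0 !mul0mx !addr0 !add0r hA hB.
Qed.

Lemma normalmx_diag n (B : 'M[C]_n) : is_diag_mx B -> B \is normalmx.
Proof.
move=> /diag_mxP[d ->]; apply/normalmxP.
by rewrite trmxC_diag diag_mxC.
Qed.

(** * Hermitian forms on row vectors and Weyl's inequality *)

Definition qform n (M : 'M[C]_n) (x : 'rV[C]_n) : C := (x *m M *m x ^t*) 0 0.

Lemma qformD n (M N : 'M[C]_n) x : qform (M + N) x = qform M x + qform N x.
Proof. by rewrite /qform mulmxDr mulmxDl mxE. Qed.

Lemma qformZ n a (M : 'M[C]_n) x : qform (a *: M) x = a * qform M x.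
Proof. by rewrite /qform -scalemxAr -scalemxAl mxE. Qed.

(** For unitary [P], the entries of [x *m P ^t*] are the coordinates of [x] in the orthonormal basis
    of rows of [P]. *)
Lemma qform_diag n (P : 'M[C]_n) (d : 'rV[C]_n) x :
  qform (P ^t* *m diag_mx d *m P) x = \sum_k d 0 k * `|(x *m P ^t*) 0 k| ^+ 2.
Proof.
rewrite /qform !mulmxA -mulmxA -[P in X in _ *m X]trmxCK -trmxC_mul.
rewrite mul_mx_diag mxE; apply: eq_bigr => k _.
by rewrite !mxE normCK mulrAC mulrC.
Qed.

Lemma qform1 n (P : 'M[C]_n) x : P \is unitarymx ->
  qform 1%:M x = \sum_k `|(x *m P ^t*) 0 k| ^+ 2.
Proof.
move=> hP; rewrite -(unitarymxK hP) -[X in X *m P]mulmx1 -diag_const_mx.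
by rewrite qform_diag; apply: eq_bigr => k _; rewrite mxE mul1r.
Qed.

Lemma qform1_gt0 n (x : 'rV[C]_n) : x != 0 -> 0 < qform 1%:M x.
Proof. by move=> /dotmx_is_dotmx; rewrite dotmxE /qform mulmx1. Qed.

Lemma qform_real n (H : 'M[C]_n) x : H \is hermsymmx -> qform H x \is Num.real.
Proof.
move=> /hermsymmxP hH; apply/CrealP; rewrite /qform.
have {2}<- : (x *m H *m x ^t*) ^t* = x *m H *m x ^t*.
  by rewrite !trmxC_mul trmxCK hH mulmxA.
by rewrite [in RHS]mxE [in RHS]mxE.
Qed.

(** Supplies the Lipschitz constant of the eigenvalue curves. The sum of the moduli of the
    eigenvalues serves as a crude bound for the largest one. *)
Lemma qform_bound n (H : 'M[C]_n) : H \is hermsymmx ->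
  exists2 c : C, 0 <= c & forall x, `|qform H x| <= c * qform 1%:M x.
Proof.
move=> /hermsymmx_diagP[P hP [d _ ->]].
exists (\sum_k `|d 0 k|) => [|x]; first by rewrite sumr_ge0.
rewrite qform_diag (qform1 x hP) (le_trans (ler_norm_sum _ _ _)) // mulr_sumr.
apply: ler_sum => k _; rewrite normrM normrX normr_id ler_wpM2r ?exprn_ge0 //.
by rewrite (bigD1 k) //= lerDl sumr_ge0.
Qed.

(* The eigenvectors of [M] for the [i+1] smallest eigenvalues and those of [N]
   for the [n-i] largest ones span spaces of total dimension [n+1], so they share
   a vector [x != 0]; [x] is a left kernel vector of a matrix with a zero
   column [i]. *)
Lemma weyl_le n (P Q : 'M[C]_n) (l m : 'I_n -> C) (c : C) (i : 'I_n) :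
    P \is unitarymx -> Q \is unitarymx ->
    {homo l : a b / (a <= b)%N >-> a <= b} ->
    {homo m : a b / (a <= b)%N >-> a <= b} ->
    let M := P ^t* *m diag_mx (\row_k l k) *m P in
    let N := Q ^t* *m diag_mx (\row_k m k) *m Q in
    (forall x, qform N x <= qform M x + c * qform 1%:M x) ->
  m i <= l i + c.
Proof.
move=> hP hQ lmono mmono M N leNM.
pose Z := \matrix_(a < n, k < n) (if (k < i)%N then (Q ^t*) a k
                          else if (i < k)%N then (P ^t*) a k else 0).
have /det0P[x x0 xZ] : \det Z == 0.
  rewrite -det_tr; apply/det0P; exists (delta_mx 0 i).
    by apply/eqP => /matrixP/(_ 0 i)/eqP; rewrite !mxE !eqxx oner_eq0.
  by rewrite -rowE; apply/rowP => a; rewrite !mxE ltnn.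
have xQ (k : 'I_n) : (k < i)%N -> (x *m Q ^t*) 0 k = 0.
  move=> ki; have := congr1 (fun X : 'rV_n => X 0 k) xZ; rewrite !mxE => e.
  rewrite -[RHS]e.
  by apply: eq_bigr => a _; rewrite !mxE ki.
have xP (k : 'I_n) : (i < k)%N -> (x *m P ^t*) 0 k = 0.
  move=> ki; have := congr1 (fun X : 'rV_n => X 0 k) xZ; rewrite !mxE => e.
  rewrite -[RHS]e.
  by apply: eq_bigr => a _; rewrite !mxE ki ltnNge (ltnW ki).
have x_gt0 := qform1_gt0 x0.
(* Only [Q]-coordinates of index at least [i] and [P]-coordinates of index at most [i] survive in
   [x]. By monotonicity the form of [N] at [x] is at least [m i] times the squared norm, and that of
   [M] at most [l i] times it. *)
rewrite -(ler_pM2r x_gt0) mulrDl; apply: le_trans (_ : qform N x <= _).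
  rewrite (qform1 x hQ) qform_diag mulr_sumr; apply: ler_sum => k _.
  case: (ltnP k i) => [/xQ ->|ik]; first by rewrite normr0 expr0n !mulr0.
  by rewrite mxE ler_wpM2r ?exprn_ge0 ?mmono.
apply: le_trans (leNM x) _; rewrite lerD2r.
rewrite (qform1 x hP) qform_diag mulr_sumr; apply: ler_sum => k _.
case: (ltnP i k) => [/xP ->|ik]; first by rewrite normr0 expr0n !mulr0.
by rewrite mxE ler_wpM2r ?exprn_ge0 ?lmono.
Qed.

End ConjugateTranspose.

(** * Continuous eigenvalues of a Hermitian pencil D + tH *)

Section HermitianPencil.
Variable R : realType.
Notation C := R[i].
Notation toC := (real_complex R).

Lemma unitarymx_perm n (p : {perm 'I_n}) : (perm_mx p : 'M[C]_n) \is unitarymx.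
Proof.
by apply/unitarymxP; rewrite tr_perm_mx map_perm_mx -perm_mxM mulgV perm_mx1.
Qed.

Lemma perm_mx_conj_diag n (p : {perm 'I_n}) (d : 'rV[C]_n) :
  (perm_mx p) ^t* *m diag_mx (col_perm p d) *m perm_mx p = diag_mx d.
Proof.
rewrite tr_perm_mx map_perm_mx -row_permE -[p in X in _ *m X]invgK -col_permE.
by apply/matrixP => i j; rewrite !mxE permKV (inj_eq perm_inj).
Qed.

Lemma sorting_perm n (d : 'I_n -> R) :
  exists p : {perm 'I_n}, {homo d \o p : a b / (a <= b)%N >-> a <= b}.
Proof.
pose t := [tuple d i | i < n].
have /tuple_permP[p tp] : perm_eq (sort <=%R t) t by rewrite perm_sort.
exists p => a b ab.
have := sorted_leq_nth le_trans le_refl 0 (sort_le_sorted t).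
rewrite tp => /(_ a b).
rewrite !inE size_tuple => /(_ (ltn_ord a) (ltn_ord b) ab).
by rewrite -!tnth_nth !tnth_mktuple.
Qed.

(** The permutation that sorts the eigenvalues is absorbed into the unitary matrix; Weyl's
    inequality compares eigenvalues by their position in this order. *)
Lemma hermsymmx_sorted n (M : 'M[C]_n) : M \is hermsymmx ->
  exists l : 'I_n -> R, {homo l : a b / (a <= b)%N >-> a <= b} /\
  exists2 P : 'M[C]_n, P \is unitarymx &
    M = P ^t* *m diag_mx (\row_k toC (l k)) *m P.
Proof.
move=> /hermsymmx_diagP[P hP [d /mxOverP dR ->]].
have [p pmono] := sorting_perm (fun i => complex.Re (d 0 i)).
exists (fun i => complex.Re (d 0 (p i))); split; first exact: pmono.
exists (perm_mx p *m P); first by rewrite mul_unitarymx ?unitarymx_perm.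
have -> : \row_k toC (complex.Re (d 0 (p k))) = col_perm p d.
  by apply/rowP => k; rewrite !mxE RRe_real ?dR.
by rewrite trmxC_mul -[in LHS](perm_mx_conj_diag p d) !mulmxA.
Qed.

(** Exchanging [x] and [y] turns the one-sided hypothesis into a two-sided bound. *)
Lemma lipschitz_continuous (f : R -> R) (c : R) : 0 <= c ->
  (forall x y, f y <= f x + c * `|y - x|) -> continuous f.
Proof.
move=> c0 fc x; apply/cvgrPdist_lt => e e0.
(* Dividing by [c + 1] instead of [c] covers the case [c = 0]. *)
have d0 : 0 < e / (c + 1) by rewrite divr_gt0 // ltr_wpDl.
near=> y.
have xy : `|x - y| < e / (c + 1) by near: y; apply: cvgr_dist_lt.
have lt1 : c * `|x - y| < e.
  apply: le_lt_trans (_ : (c + 1) * `|x - y| < e).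
    by rewrite ler_wpM2r // lerDl.
  by rewrite mulrC -ltr_pdivlMr // ltr_wpDl.
apply: le_lt_trans lt1; rewrite ler_norml lerBlDl lerNl opprB lerBlDl.
by rewrite fc distrC fc.
Unshelve. all: by end_near. Qed.

(** At each [t] separately, [l i t] is the i-th smallest eigenvalue; Weyl's inequality between two
    parameters makes it Lipschitz. The unitary [P] is chosen anew for each [t]. *)
Lemma pencil_eigenvalues n (D H : 'M[C]_n) :
    D \is hermsymmx -> H \is hermsymmx ->
  exists l : 'I_n -> R -> R, (forall i, continuous (l i)) /\
  forall t, exists2 P : 'M[C]_n, P \is unitarymx &
    D + toC t *: H = P ^t* *m diag_mx (\row_k toC (l k t)) *m P.
Proof.
move=> hD hH.
have hM t : D + toC t *: H \is hermsymmx.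
  apply/hermsymmxP; rewrite trmxCD trmxCZ (hermsymmxP hD) (hermsymmxP hH).
  by congr (_ + _ *: _); exact: conjc_real.
have /choice[l lP] := fun t => hermsymmx_sorted (hM t).
exists (fun i t => l t i); split=> [i|t]; last by have [] := lP t.
have [c c0 cP] := qform_bound hH.
have cE : c = toC (complex.Re c) by rewrite RRe_real // ger0_real.
apply: (@lipschitz_continuous _ (complex.Re c)).
  by rewrite -lecR -cE.
move=> t t'; have [lmono [P hP eP]] := lP t; have [mmono [Q hQ eQ]] := lP t'.
rewrite -lecR rmorphD rmorphM /= -cE mulrC.
apply: (weyl_le (l := toC \o l t) (m := toC \o l t') _ hP hQ).
- by move=> a b ab; rewrite lecR lmono.
- by move=> a b ab; rewrite lecR mmono.
move=> x; rewrite -eP -eQ.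
(* Passing from [t] to [t'] adds (t' - t)H, whose form is at most c|t' - t| times the squared
   norm. *)
have -> : D + toC t' *: H = (D + toC t *: H) + toC (t' - t) *: H.
  by rewrite -addrA -scalerDl -rmorphD subrKC.
rewrite qformD lerD2l qformZ; apply: le_trans (real_ler_norm _) _.
  by rewrite rpredM ?qform_real //; apply/complex_realP; exists (t' - t).
have -> : toC `|t' - t| = `|toC (t' - t)|.
  by rewrite normc_def /= expr0n addr0 sqrtr_sqr.
by rewrite normrM -mulrA ler_wpM2l.
Qed.
End HermitianPencil.

(** * Motion of the eigenvalues of A + tE along the lines *)

Section EigenvalueMotion.
Variable R : realType.
Notation C := R[i].
Notation toC := (real_complex R).
Local Open Scope classical_set_scope.

Lemma char_poly_bdiag n m q (s : 'I_m -> nat) (e : (\sum_(j < m) s j + q)%N = n)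
    (D : forall j, 'M[C]_(s j)) (B : 'M[C]_q) :
  char_poly (bdiag e D B) = (\prod_j char_poly (D j)) * char_poly B.
Proof.
by case: _ / e; rewrite /bdiag castmx_id char_poly_block_diag char_poly_mxdiag.
Qed.

Lemma bdiagD n m q (s : 'I_m -> nat) (e : (\sum_(j < m) s j + q)%N = n)
    (D D' : forall j, 'M[C]_(s j)) (B B' : 'M[C]_q) :
  bdiag e D B + bdiag e D' B' = bdiag e (fun j => D j + D' j) (B + B').
Proof.
by case: _ / e; rewrite /bdiag !castmx_id add_block_mx mxdiagD !addr0.
Qed.

Lemma bdiagZ n m q (s : 'I_m -> nat) (e : (\sum_(j < m) s j + q)%N = n)
    a (D : forall j, 'M[C]_(s j)) (B : 'M[C]_q) :
  a *: bdiag e D B = bdiag e (fun j => a *: D j) (a *: B).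
Proof.
case: _ / e; rewrite /bdiag !castmx_id scale_block_mx !scaler0.
congr block_mx; rewrite -mul_scalar_mx -mxdiagZ mul_mxdiag.
by apply: eq_mxdiag => j; rewrite mul_scalar_mx.
Qed.

Lemma eq_bdiag n m q (s : 'I_m -> nat) (e : (\sum_(j < m) s j + q)%N = n)
    (D D' : forall j, 'M[C]_(s j)) (B : 'M[C]_q) :
  (forall j, D j = D' j) -> bdiag e D B = bdiag e D' B.
Proof.
by move=> eD; rewrite /bdiag (eq_mxdiag eD).
Qed.

Lemma char_poly_affine n (P : 'M[C]_n) (y theta : C) (l : 'I_n -> C) :
  P \is unitarymx ->
  char_poly (y%:M + theta *: (P ^t* *m diag_mx (\row_k l k) *m P)) =
  \prod_k ('X - (y + theta * l k)%:P).
Proof.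
move=> hP; have -> : y%:M + theta *: (P ^t* *m diag_mx (\row_k l k) *m P) =
    P ^t* *m diag_mx (\row_k (y + theta * l k)) *m P.
  have -> : diag_mx (\row_k (y + theta * l k)) =
      y%:M + theta *: diag_mx (\row_k l k).
    apply/matrixP => i j; rewrite !mxE.
    by case: (i == j); rewrite ?mulr1n ?mulr0n ?mulr0 ?addr0.
  rewrite mulmxDr mulmxDl mul_mx_scalar -!scalemxAr -!scalemxAl.
  by rewrite unitarymxK // scalemx1.
by rewrite char_poly_conj // char_poly_diag; under eq_bigr do rewrite mxE.
Qed.

Lemma hermsymmx_real_diag n (D : 'M[R]_n) :
  is_diag_mx D -> map_mx toC D \is hermsymmx.
Proof.
move=> /diag_mxP[d ->]; apply/hermsymmxP; rewrite map_diag_mx trmxC_diag.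
by congr diag_mx; apply/rowP => k; rewrite !mxE; exact: conjc_real.
Qed.

(** The end points are the minimum and the maximum of [f] on the interval; the intermediate value
    theorem fills in what lies between. *)
Lemma itv_image (f : R -> R) : continuous f ->
  exists a b : R, f @` `[0, 1] = [set a + t * (b - a) | t in `[0, 1]].
Proof.
move=> cf; have wcf (a b : R) : {within `[a, b], continuous f}.
  exact: continuous_subspaceT.
have [u u01 fu] := EVT_min (@ler01 R) (wcf 0 1).
have [v v01 fv] := EVT_max (@ler01 R) (wcf 0 1).
exists (f u), (f v); apply/seteqP; split=> [_ [t t01 <-]|_ [t /= t01 <-]] /=.
  have ut : f u <= f t by apply: fu.
  have tv : f t <= f v by apply: fv.
  (* If [f] is constant on the interval the quotient below would divide by 0; the parameter 0 does
     instead. *)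
  have [uv|uv] := eqVneq (f u) (f v).
    exists 0; first by rewrite /= in_itv /= lexx ler01.
    by rewrite mul0r addr0; apply/eqP; rewrite eq_le ut uv tv.
  have uv0 : 0 < f v - f u by rewrite subr_gt0 lt_neqAle uv (le_trans ut).
  exists ((f t - f u) / (f v - f u)).
    rewrite /= in_itv /= divr_ge0 ?(ltW uv0) ?subr_ge0 //=.
    by rewrite ler_pdivrMr // mul1r lerD2r.
  by rewrite divfK ?gt_eqF // subrKC.
set w := f u + _.
have [wu wv] : f u <= w /\ w <= f v.
  have uv : 0 <= f v - f u by rewrite subr_ge0 fv.
  move: t01; rewrite in_itv /= => /andP[t0 t1]; split.
    by rewrite lerDl mulr_ge0.
  by rewrite -lerBrDl ler_piMl.
(* The minimum may be attained before or after the maximum, hence a form that is symmetric in the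
   two values. *)
have ivt a b : a \in `[0, 1]%R -> b \in `[0, 1]%R -> a <= b ->
    Num.min (f a) (f b) <= w <= Num.max (f a) (f b) ->
    exists2 x, `[0, 1] x & f x = w.
  rewrite !in_itv /= => /andP[a0 a1] /andP[b0 b1] ab /(IVT ab (wcf a b))[x].
  rewrite in_itv /= => /andP[ax xb] fx; exists x => //=.
  by rewrite in_itv /= (le_trans a0) // (le_trans xb).
have [uv|vu] := leP u v; [apply: (ivt u v)|apply: (ivt v u)] => //; try exact: ltW.
  by rewrite ge_min wu le_max wv orbT.
by rewrite ge_min wu orbT le_max wv.
Qed.

Lemma affine_curve (y theta : C) (f : R -> R) :
    `|theta| = 1 -> continuous f ->
  let gamma t := y + theta * toC (f t) in
  [/\ {within `[0 : R, 1 : R], continuous (gamma : R -> (C : numFieldType))},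
      is_segment [set gamma t | t in `[0 : R, 1 : R]] &
      [set gamma t | t in `[0 : R, 1 : R]] `<=` line theta y].
Proof.
move=> th1 cf gamma; split.
- apply: continuous_subspaceT => x; apply/cvgrPdist_lt => e e0.
  (* A positive element of [C] is real, so [e] yields a radius in [R]. *)
  have eE : e = toC (complex.Re e) by rewrite RRe_real // gtr0_real.
  have e0' : 0 < complex.Re e by rewrite -ltcR -eE.
  near=> t.
  (* Since [theta] is unimodular, two points of the curve are as far apart as the corresponding
     values of [f]. *)
  rewrite opprD addrACA subrr add0r -mulrBr normrM th1 mul1r -rmorphB.
  rewrite normc_def /= expr0n addr0 sqrtr_sqr eE ltcR.
  by near: t; apply: cvgr_dist_lt e0'; exact: cf.
- have [a [b fab]] := itv_image cf.
  exists (y + theta * toC a), (y + theta * toC b).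
  have -> : [set gamma t | t in `[0 : R, 1 : R]] =
      (fun z => y + theta * toC z) @` (f @` `[0, 1]) by rewrite image_comp.
  rewrite fab image_comp; apply: eq_imagel => t _ /=.
  by rewrite rmorphD rmorphM rmorphB /=; ring.
- by move=> _ [t _ <-]; exists (f t).
Unshelve. all: by end_near. Qed.

(** Block [j] contributes the curves y_j + theta l(t), where l runs over the ordered eigenvalues of
    R_j + tH_j. A flat index is split into its block ([tagnat.sig1]) and its position there
    ([tagnat.sig2]). *)
Lemma block_form_motion (n k : nat) (theta : C) (A E : 'M[C]_n)
    (m : nat) (s : 'I_m -> nat) (y : 'I_m -> C) (q : nat) (B : 'M[C]_q) :
  `|theta| = 1 -> block_form k theta A E s y B ->
  eigenvalue_motion theta A E s y B.
Proof.
move=> th1 [_ _ _ Bdiag [e [ks [U [D [H [_ [hU _] hD hH [eA eE]]]]]]]].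
pose pencil j := cid (pencil_eigenvalues (hermsymmx_real_diag (hD j)) (hH j).1).
pose l j := sval (pencil j).
pose gamma (i : 'I_(\sum_(j < m) s j)) t :=
  y (tagnat.sig1 i) + theta * toC (l _ (tagnat.sig2 i) t).
pose b := [seq B i i | i : 'I_q].
have specB : spectrum_is B b.
  move/diag_mxP: Bdiag => [d eB]; rewrite /spectrum_is /b eB char_poly_diag.
  by rewrite big_image /=; apply: eq_bigr => i _; rewrite mxE eqxx.
(* Proved for all [t] at once; [t = 0] and [t = 1] then give the spectra of [A] and [A + E]. *)
have spec t : spectrum_is (A + toC t *: E) ([seq gamma i t | i : 'I__] ++ b).
  rewrite /spectrum_is -(char_poly_conj (A + _) hU) mulmxDr mulmxDl.
  rewrite -scalemxAr -scalemxAl eA eE bdiagZ bdiagD scaler0 addr0.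
  rewrite char_poly_bdiag big_cat /= specB; congr (_ * _).
  transitivity (\prod_j \prod_k ('X - (y j + theta * toC (l j k t))%:P)).
    apply: eq_bigr => j _; have [_ /(_ t)[P hP eP]] := svalP (pencil j).
    (* Regroups the block as y + theta(R + tH), so that the diagonalised pencil appears. *)
    rewrite -addrA [toC t *: _]scalerA [toC t * _]mulrC -scalerA -scalerDr eP.
    exact: char_poly_affine.
  by rewrite big_image sig_big_dep /= (reindex _ tagnat.sig_bij_on).
exists b, (fun i => gamma i 0), (fun i => gamma i 1), gamma.
have curve i := affine_curve (y (tagnat.sig1 i)) th1
  ((svalP (pencil (tagnat.sig1 i))).1 (tagnat.sig2 i)).
split=> //.
- by have := spec 0; rewrite scale0r addr0.
- by have := spec 1; rewrite scale1r.
- by move=> i; exists (tagnat.sig1 i), (l _ (tagnat.sig2 i) 1).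
split=> // i; have [ci si li] := curve i.
by split=> //; exists (tagnat.sig1 i).
Qed.
End EigenvalueMotion.

(** * Normality under a Hermitian perturbation, and grouping indices into blocks *)

Section Normality.
Variable C : numClosedFieldType.

Lemma normalmx_add_herm_commute n (a h : 'M[C]_n) :
    a \is normalmx -> h \is hermsymmx -> a + h \is normalmx ->
  (a - a ^t*) *m h = h *m (a - a ^t*).
Proof.
move=> /normalmxP na /hermsymmxP hh /normalmxP nah.
(* What is left of the normality equation of [a + h] after cancelling the terms without mixed
   products. *)
have eq : a *m h + h *m a ^t* = a ^t* *m h + h *m a.
  move: nah; rewrite trmxCD hh !mulmxDl !mulmxDr na -!addrA => /addrI.
  by rewrite !addrA => /addIr.
rewrite mulmxBl mulmxBr -[a *m h](addrK (h *m a ^t*)) eq addrAC.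
by rewrite [X in X - _ - _]addrC addrK.
Qed.

Lemma normalmx_diag_add_herm n (c : 'rV[C]_n) (g : 'M[C]_n) i j :
    g \is hermsymmx -> diag_mx c + g \is normalmx ->
  'Im (c 0 i) != 'Im (c 0 j) -> g i j = 0.
Proof.
move=> hg ng cij; have nc := normalmx_diag (diag_mx_is_diag c).
have := normalmx_add_herm_commute nc hg ng.
rewrite trmxC_diag -raddfB /= => /matrixP/(_ i j).
rewrite mul_diag_mx mul_mx_diag !mxE => /eqP.
rewrite [X in _ == X]mulrC -subr_eq0 -mulrBl mulf_eq0 => /orP[|/eqP //].
(* Entry (i, j) of the commutation relation is [g i j] times a difference of two such terms, which
   is 2i times the difference of the imaginary parts. *)
have subCE (x : C) : x - x^* = 'i * 'Im x *+ 2.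
  rewrite {1 2}[x]Crect rmorphD rmorphM /= conjCi !conj_Creal ?Creal_Re ?Creal_Im //.
  by rewrite mulNr opprD opprK addrACA subrr add0r mulr2n.
rewrite !subCE -mulrnBl -mulrBr mulrn_eq0 mulf_eq0 (negPf (neq0Ci _)) subr_eq0.
by rewrite (negPf cij).
Qed.

Lemma rank_bdiag n m q (s : 'I_m -> nat) (e : (\sum_(j < m) s j + q)%N = n)
    (D : forall j, 'M[C]_(s j)) (B : 'M[C]_q) :
  \rank (bdiag e D B) = (\sum_j \rank (D j) + \rank B)%N.
Proof.
by case: _ / e; rewrite /bdiag castmx_id rank_diag_block_mx rank_mxdiag.
Qed.

Lemma normalmx_bdiag n m q (s : 'I_m -> nat) (e : (\sum_(j < m) s j + q)%N = n)
    (D : forall j, 'M[C]_(s j)) (B : 'M[C]_q) :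
  (forall j, D j \is normalmx) -> B \is normalmx -> bdiag e D B \is normalmx.
Proof.
case: _ / e => hD hB; rewrite /bdiag castmx_id.
by apply: normalmx_block_diag => //; exact: normalmx_mxdiag.
Qed.

(** Listing the fibres of [f] one after another gives the permutation [p]. A matrix that couples
    only indices of the same fibre becomes block diagonal in this order, with one block per value of
    [f] and an empty trailing block. *)
Lemma fibre_blocks (T : eqType) n (f : 'I_n -> T) :
  exists (m : nat) (s : 'I_m -> nat) (v : 'I_m -> T)
      (e : (\sum_(j < m) s j + 0)%N = n) (p : {perm 'I_n})
      (t : forall j, 'I_(s j) -> 'I_n),
    [/\ forall j, (0 < s j)%N, injective v,
        forall j, injective (t j), forall j a, f (t j a) = v j &
        forall X : 'M[C]_n, (forall i j, f i != f j -> X i j = 0) ->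
          mxsub p p X = bdiag e (fun j => mxsub (t j) (t j) X) 0].
Proof.
pose vals := undup (codom f); pose m := size vals.
pose v (j : 'I_m) := tnth (in_tuple vals) j.
have cls_lt i : (index (f i) vals < m)%N.
  by rewrite index_mem mem_undup codom_f.
pose cls i : 'I_m := Ordinal (cls_lt i).
have v_cls i : v (cls i) = f i.
  by rewrite /v (tnth_nth (f i)) /= nth_index // mem_undup codom_f.
have v_inj : injective v.
  have : uniq (in_tuple vals) by rewrite undup_uniq.
  by move=> /tuple_uniqP.
pose s (j : 'I_m) := #|[set i | f i == v j]|.
pose t (j : 'I_m) (a : 'I_(s j)) : 'I_n := enum_val a.
have t_inj j : injective (@t j) by move=> a b; apply: enum_val_inj.
have ft j a : f (@t j a) = v j.
  by have := enum_valP a; rewrite inE => /eqP.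
(* The fibres partition the index set, so their sizes add up to [n]. *)
have e0 : (\sum_(j < m) s j)%N = n.
  rewrite -[RHS]card_ord -sum1_card (partition_big cls xpredT) //=.
  apply: eq_bigr => j _; rewrite sum1dep_card; apply: eq_card => i.
  by rewrite !inE -v_cls (inj_eq v_inj).
pose g (k : 'I_(\sum_(j < m) s j)) := t (tagnat.sig1 k) (tagnat.sig2 k).
have g_inj : injective g.
  move=> k l; rewrite /g /tagnat.sig1 /tagnat.sig2 => gkl.
  apply: tagnat.sig_inj; move: gkl.
  case: (tagnat.sig k) (tagnat.sig l) => [i a] [j b] /= tab.
  (* Equal images have equal values under [f], which forces the same block; within it, [t] is
     injective. *)
  have eij : i = j by apply: v_inj; rewrite -(ft i a) tab ft.
  by case: _ / eij in b tab *; rewrite (t_inj _ _ _ tab).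
have p_inj : injective (fun i : 'I_n => g (cast_ord (esym e0) i)).
  by move=> i j /g_inj/cast_ord_inj.
pose e := etrans (addn0 _) e0.
exists m, s, v, e, (perm p_inj), t; split=> // [j|X X0].
  have := mem_tnth j (in_tuple vals).
  rewrite mem_undup => /codomP[i fi]; apply/card_gt0P; exists i.
  by rewrite inE /v -fi.
apply/matrixP => i j; rewrite /bdiag castmxE [LHS]mxE !permE.
(* As the trailing block has size 0, every index falls in the upper left block. *)
have lsh (k : 'I_n) : cast_ord (esym e) k = lshift 0 (cast_ord (esym e0) k).
  exact: val_inj.
rewrite !lsh block_mxEul mxE /g /tagnat.sig1 /tagnat.sig2.
case: (tagnat.sig _) (tagnat.sig _) => [k a] [l b] /=.
case: (l =P k) => [elk|/eqP lk].
  by case: _ / elk in a *; rewrite conform_mx_id mxE.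
by rewrite mxE X0 // !ft (inj_eq v_inj).
Qed.

End Normality.

(** * Equivalence of the block form and the normality of A + E *)

Section BlockForm.
Variable R : realType.
Notation C := R[i].
Notation toC := (real_complex R).

(** After conjugation by [U], each block of [A + E] is y + theta(R + H) with R + H Hermitian, hence
    normal, and the trailing block is diagonal. *)
Lemma block_form_normal (n k : nat) (theta : C) (A E : 'M[C]_n)
    (m : nat) (s : 'I_m -> nat) (y : 'I_m -> C) (q : nat) (B : 'M[C]_q) :
  block_form k theta A E s y B -> A + E \is normalmx.
Proof.
move=> [_ _ _ Bdiag [e [ks [U [D [H [_ [hU _] hD hH [eA eE]]]]]]]].
rewrite -(normalmx_conj (A + E) hU) mulmxDr mulmxDl eA eE bdiagD addr0.
apply: normalmx_bdiag => [j|]; last exact: normalmx_diag.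
rewrite -addrA -scalerDr; apply/normalmx_affine/hermitian_normalmx/hermsymmxP.
rewrite trmxCD (hermsymmxP (hermsymmx_real_diag (hD j))).
by rewrite (hermsymmxP (hH j).1).
Qed.

(** The first base point lies on the second line; dividing by [theta] and comparing imaginary parts
    identifies [v] and [w]. *)
Lemma line_inj (theta : C) (v w : R) : theta != 0 ->
  line theta (theta * ('i * toC v)) = line theta (theta * ('i * toC w)) -> v = w.
Proof.
move=> th0 eq_line.
have : line theta (theta * ('i * toC v)) (theta * ('i * toC v)).
  by exists 0 => //; rewrite rmorph0 mulr0 addr0.
rewrite eq_line => -[r _]; rewrite -mulrDr => /(mulfI th0).
rewrite -complexiE => /(congr1 (@complex.Im R)) /=.
by rewrite !(mul0r, mul1r, mulr0, add0r, addr0, oppr0).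
Qed.

Lemma normal_block_form (n k : nat) (theta : C) (A E : 'M[C]_n) :
    A \is normalmx -> `|theta| = 1 -> (0 < n)%N ->
    theta_hermitian theta E -> \rank E = k -> A + E \is normalmx ->
  exists (m : nat) (s : 'I_m -> nat) (y : 'I_m -> C) (q : nat) (B : 'M[C]_q),
    block_form k theta A E s y B.
Proof.
move=> nA th1 n0 hE rkE nAE.
have th0 : theta != 0 by rewrite -normr_eq0 th1 oner_eq0.
have thC : theta * theta^* = 1 by rewrite -normCK th1 expr1n.
have [P hP [d eA]] := normalmx_diagP nA.
(* In the eigenbasis of [A], [c] holds the eigenvalues of [A] divided by [theta], and [g] is the
   Hermitian matrix obtained from [E]. *)
pose c := theta^* *: d; pose g := P *m (theta^* *: E) *m P ^t*.
have hg : g \is hermsymmx by exact: hermsymmx_conj.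
have ng : diag_mx c + g \is normalmx.
  rewrite -(normalmx_conj _ hP).
  have -> : P ^t* *m (diag_mx c + g) *m P = 0%:M + theta^* *: (A + E).
    rewrite raddf0 add0r mulmxDr mulmxDl scalerDr /c linearZ /= -scalemxAr.
    by rewrite -scalemxAl -eA /g !mulmxA unitarymxK // mul1mx mulmxKtV.
  exact: (normalmx_affine _ _ nAE).
pose f i := complex.Im (c 0 i).
have [m [s [v [e [p [t [s0 v_inj t_inj ft blocks]]]]]]] := fibre_blocks C f.
have g0 i j : f i != f j -> g i j = 0.
  move=> fij; apply: (normalmx_diag_add_herm hg ng); apply: contraNneq fij.
  by rewrite -!complexIm /f => /complexI ->.
(* [Q] is the change to the eigenbasis followed by the reordering into fibres. *)
have [Q hQ conjQ] : exists2 Q, Q \is unitarymx &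
    forall X, Q *m X *m Q ^t* = mxsub p p (P *m X *m P ^t*).
  exists (perm_mx p *m P) => [|X]; first by rewrite mul_unitarymx ?unitarymx_perm.
  rewrite trmxC_mul tr_perm_mx map_perm_mx !mulmxA.
  rewrite -col_permE -!mulmxA -row_permE.
  by apply/matrixP => i j; rewrite !mxE.
have PAP : P *m A *m P ^t* = diag_mx d.
  by rewrite eA !mulmxA (unitarymxP hP) mul1mx mulmxtVK.
have PEP : P *m E *m P ^t* = theta *: g.
  by rewrite /g -scalemxAr -scalemxAl scalerA thC scale1r.
(* The imaginary part is constant on a fibre and gives the base point y_j = theta i v_j; the real
   parts form R_j. *)
have dE i : d 0 i = theta * (toC (complex.Re (c 0 i)) + 'i * toC (f i)).
  by rewrite complexRe complexIm -Crect mxE mulrA thC mul1r.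
pose D j := diag_mx (\row_a complex.Re (c 0 (t j a))) : 'M[R]_(s j).
pose H j := mxsub (t j) (t j) g.
have QAQ : Q *m A *m Q ^t* = bdiag e (fun j =>
    (theta * ('i * toC (v j)))%:M + theta *: map_mx toC (D j)) 0.
  rewrite conjQ PAP blocks => [|i j]; last first.
    by rewrite mxE; case: (eqVneq i j) => // ->; rewrite eqxx.
  apply: eq_bdiag => j; apply/matrixP => a b; rewrite !mxE (inj_eq (@t_inj j)).
  case: eqVneq => [->|_]; last by rewrite !mulr0n rmorph0 mulr0 addr0.
  by rewrite !mulr1n [LHS]dE ft mulrDr addrC mxE.
have QEQ : Q *m E *m Q ^t* = bdiag e (fun j => theta *: H j) 0.
  rewrite conjQ PEP blocks => [|i j fij]; last by rewrite mxE g0 ?mulr0.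
  by apply: eq_bdiag => j; apply/matrixP => a b; rewrite !mxE.
exists m, s, (fun j => theta * ('i * toC (v j))), 0, 0; split=> //.
(* Without blocks [n] would be 0. *)
- case: posnP => // m0; move: n0; rewrite -e addn0 big1 // => j _.
  by have := leq_trans (ltn_ord j) (eq_leq m0).
- by move=> i j /line_inj ij; apply: v_inj; apply: ij.
- by apply/is_diag_mxP => -[].
exists e, (fun j => \rank (H j)), (Q ^t*), D, H; rewrite trmxCK; split; last by split.
(* Rank is unchanged by unitary conjugation and by the nonzero factor [theta], so the block ranks
   add up to that of [E]. *)
- transitivity (\rank (Q *m E *m Q ^t*)).
    rewrite QEQ rank_bdiag mxrank0 addn0.
    by apply: eq_bigr => j _; rewrite mxrank_scale_nz.
  rewrite mxrankMfree ?row_free_unit ?unitarymx_unit ?trmxC_unitary //.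
  rewrite -mxrank_tr trmx_mul mxrankMfree ?mxrank_tr //.
  by rewrite row_free_unit unitmx_tr unitarymx_unit.
- split=> [|i]; first by rewrite trmxC_unitary.
  split.
    (* [Q] maps this column to a standard basis vector, so it is nonzero. *)
    apply/eqP => /(congr1 (mulmx Q)); rewrite mulmx0 colE mulmxA (unitarymxP hQ).
    by rewrite mul1mx => /matrixP/(_ i 0)/eqP; rewrite !mxE !eqxx oner_eq0.
  exists (d 0 (p i)).
  have : A *m Q ^t* = Q ^t* *m diag_mx (col_perm p d).
    transitivity (Q ^t* *m (Q *m A *m Q ^t*)).
      by rewrite !mulmxA unitarymxK // mul1mx.
    rewrite conjQ PAP.
    by congr (_ *m _); apply/matrixP => a b; rewrite !mxE (inj_eq perm_inj).
  rewrite colE mulmxA => ->; rewrite -!colE; apply/matrixP => a b.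
  by rewrite mul_mx_diag !mxE mulrC.
- by move=> j; exact: diag_mx_is_diag.
- by move=> j; split; [exact: (hermsymmx_mxsub (t j) hg)|].
Qed.

End BlockForm.


Theorem theorem4p14 (R : realType) (n k : nat) (A E : 'M[R[i]]_n) (theta : R[i]) :
  A \is normalmx ->
  `|theta| = 1 ->
  (1 <= k <= n)%N ->
  theta_hermitian theta E ->
  \rank E = k ->
  (A + E \is normalmx <->
     exists (m : nat) (s : 'I_m -> nat) (y : 'I_m -> R[i])
            (q : nat) (B : 'M[R[i]]_q),
       block_form k theta A E s y B)
  /\
  (forall (m : nat) (s : 'I_m -> nat) (y : 'I_m -> R[i])
          (q : nat) (B : 'M[R[i]]_q),
     block_form k theta A E s y B ->
     eigenvalue_motion theta A E s y B).
Proof.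
move=> nA th1 /andP[k0 kn] hE rkE; split; last first.
  by move=> m s y q B; apply: block_form_motion.
split=> [nAE|[m [s [y [q [B]]]]]]; last exact: block_form_normal.
by apply: normal_block_form => //; apply: leq_trans kn.
Qed.
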